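(* Let $\mathbf A\in\mathbb R^{m\times n}$, $m\ge n$, have singular values $\sigma_1\ge\dots\ge\sigma_n\ge0$ and SVD $\mathbf A=\mathbf U_{\mathrm A}\mathbf\Sigma_{\mathrm A}\mathbf V_{\mathrm A}^T=\mathbf A_k+\mathbf A_0$ (with $\mathbf A_k$ the part carried by the $k$ largest singular values and $\mathbf A_0$ the remaining part), where $\sigma_k>0$. Let $k\le\ell<n$ and let $p\ge0$ be an integer with $2\le p+k\le\ell$. Let $\hat{\mathbf A}_{\text{CoR}}$ be computed by the basic CoR-UTV algorithm with Gaussian test matrix $\mathbf\Psi\in\mathbb R^{n\times\ell}$. Write $\widetilde{\mathbf\Psi}=\mathbf V_{\mathrm A}^T\mathbf\Psi=[\widetilde{\mathbf\Psi}_1^T\ \ \widetilde{\mathbf\Psi}_2^T]^T$, where $\widetilde{\mathbf\Psi}_1$ has $\ell-p$ rows and $\widetilde{\mathbf\Psi}_2$ has $n-\ell+p$ rows, and assume that $\widetilde{\mathbf\Psi}_1$ has full row rank. Then, for $\xi=2$ and for $\xi=F$, $$\|\mathbf A-\hat{\mathbf A}_{\text{CoR}}\|_\xi\le\|\mathbf A_0\|_\xi+\sqrt{\frac{\alpha^2\|\widetilde{\mathbf\Psi}_2\|_2^2\|\widetilde{\mathbf\Psi}_1^\dagger\|_2^2}{1+\beta^2\|\widetilde{\mathbf\Psi}_2\|_2^2\|\widetilde{\mathbf\Psi}_1^\dagger\|_2^2}}+\sqrt{\frac{\eta^2\|\widetilde{\mathbf\Psi}_2\|_2^2\|\widetilde{\mathbf\Psi}_1^\dagger\|_2^2}{1+\tau^2\|\widetilde{\mathbf\Psi}_2\|_2^2\|\widetilde{\mathbf\Psi}_1^\dagger\|_2^2}},$$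 where $$\alpha=\sqrt k\,\frac{\sigma_{\ell-p+1}^2}{\sigma_k},\quad \beta=\frac{\sigma_{\ell-p+1}^2}{\sigma_1\sigma_k},\quad \eta=\sqrt k\,\sigma_{\ell-p+1},\quad \tau=\frac{\sigma_{\ell-p+1}}{\sigma_1}.$$ If instead $\hat{\mathbf A}_{\text{CoR}}$ is computed by CoR-UTV with the power method with parameter $q$, the same inequality holds with $$\alpha=\sqrt k\,\frac{\sigma_{\ell-p+1}^2}{\sigma_k}\Big(\frac{\sigma_{\ell-p+1}}{\sigma_k}\Big)^{2q},\quad \beta=\frac{\sigma_{\ell-p+1}^2}{\sigma_1\sigma_k}\Big(\frac{\sigma_{\ell-p+1}}{\sigma_k}\Big)^{2q},\quad \eta=\frac{\sigma_k}{\sigma_{\ell-p+1}}\alpha,\quad \tau=\frac{\sigma_k}{\sigma_{\ell-p+1}}\beta .$$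
   Context: $\|\cdot\|_2$ is the spectral norm, $\|\cdot\|_F$ the Frobenius norm, and $\dagger$ the Moore-Penrose pseudo-inverse. SVD: $\mathbf A=\mathbf U_{\mathrm A}\mathbf\Sigma_{\mathrm A}\mathbf V_{\mathrm A}^T$ with $\mathbf U_{\mathrm A}=[\mathbf U_k\ \mathbf U_0]\in\mathbb R^{m\times n}$ and $\mathbf V_{\mathrm A}=[\mathbf V_k\ \mathbf V_0]\in\mathbb R^{n\times n}$ having orthonormal columns, $\mathbf\Sigma_{\mathrm A}=\mathrm{diag}(\mathbf\Sigma_k,\mathbf\Sigma_0)$, $\mathbf\Sigma_k=\mathrm{diag}(\sigma_1,\dots,\sigma_k)$, $\mathbf\Sigma_0=\mathrm{diag}(\sigma_{k+1},\dots,\sigma_n)$; $\mathbf A_k=\mathbf U_k\mathbf\Sigma_k\mathbf V_k^T$ and $\mathbf A_0=\mathbf U_0\mathbf\Sigma_0\mathbf V_0^T$. Basic CoR-UTV algorithm with inputs $\mathbf A,k,\ell$ ($k\le\ell<n$): draw $\mathbf\Psi\in\mathbb R^{n\times\ell}$ with i.i.d. standard Gaussian entries; set $\mathbf C_1=\mathbf A\mathbf\Psi$ and $\mathbf C_2=\mathbf A^T\mathbf C_1$; compute (reduced) QR decompositions $\mathbf C_1=\mathbf Q_1\mathbf R_1$, $\mathbf C_2=\mathbf Q_2\mathbf R_2$ ($\mathbf Q_1\in\mathbb R^{m\times\ell}$, $\mathbf Q_2\in\mathbb R^{n\times\ell}$ with orthonormal columns); set $\mathbf D=\mathbf Q_1^T\mathbf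 A\mathbf Q_2\in\mathbb R^{\ell\times\ell}$; compute a column-pivoted QR decomposition $\mathbf D=\widetilde{\mathbf Q}\widetilde{\mathbf R}\widetilde{\mathbf P}^T$ ($\widetilde{\mathbf Q}$ orthogonal, $\widetilde{\mathbf R}$ upper triangular, $\widetilde{\mathbf P}$ a permutation matrix); output $\hat{\mathbf A}_{\text{CoR}}=\mathbf U\mathbf T\mathbf V^T$ with $\mathbf U=\mathbf Q_1\widetilde{\mathbf Q}$, $\mathbf T=\widetilde{\mathbf R}$, $\mathbf V=\mathbf Q_2\widetilde{\mathbf P}$, so that $\hat{\mathbf A}_{\text{CoR}}=\mathbf Q_1\mathbf D\mathbf Q_2^T$. CoR-UTV with power method, with an additional integer input $q\ge0$: the same, except that $\mathbf C_1,\mathbf C_2$ are obtained by initializing $\mathbf C_2=\mathbf\Psi$ and performing $q+1$ times the two updates $\mathbf C_1\leftarrow\mathbf A\mathbf C_2$, $\mathbf C_2\leftarrow\mathbf A^T\mathbf C_1$; that is, $\mathbf C_1=\mathbf A(\mathbf A^T\mathbf A)^q\mathbf\Psi$ and $\mathbf C_2=(\mathbf A^T\mathbf A)^{q+1}\mathbf\Psi$. In the power-method formulas the quotients by $\sigma_{\ell-p+1}$ are understood with the cancellation against the factors of $\sigma_{\ell-p+1}$ in $\alpha$ and $\beta$.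
   Formalization: For the spectral norm the inequality is proved for almost every outcome of the Gaussian matrix with full-row-rank Psi~_1, not every one: it can fail when C_1 is rank-deficient and its QR factors are not unique, a null event. The Frobenius bound holds for every outcome. *)

(* Defs.v *)
From HB Require Import structures.
From mathcomp Require Import all_boot all_order all_algebra.
From mathcomp Require Import all_classical all_reals all_analysis.
From mathcomp Require Import ring.

Set Implicit Arguments.
Unset Strict Implicit.
Unset Printing Implicit Defensive.

Import Order.TTheory GRing.Theory Num.Theory.
Local Open Scope classical_set_scope.
Local Open Scope ring_scope.

Section Norms.
Context {R : realType}.

Definition normF m n (M : 'M[R]_(m, n)) : R :=
  Num.sqrt (\sum_i \sum_j M i j ^+ 2).

(* The Euclidean norm of a column vector is its Frobenius norm, so this is the
   operator norm induced by the Euclidean norms. *)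
Definition norm2 m n (M : 'M[R]_(m, n)) : R :=
  sup [set normF (M *m x) | x in [set x : 'cV[R]_n | normF x <= 1]].

Definition moore_penrose m n (M : 'M[R]_(m, n)) (X : 'M[R]_(n, m)) : Prop :=
  [/\ M *m X *m M = M, X *m M *m X = X,
      (M *m X)^T = M *m X & (X *m M)^T = X *m M].

Definition mp_pinv m n (M : 'M[R]_(m, n)) : 'M[R]_(n, m) :=
  xget 0 [set X | moore_penrose M X].

Lemma mulmx_trmx_eq0 m n (M : 'M[R]_(m, n)) : M *m M^T = 0 -> M = 0.
Proof.
move=> M0; apply/matrixP => i j; rewrite mxE.
have /matrixP/(_ i i) := M0; rewrite !mxE => /eqP.
rewrite psumr_eq0 => [/allP/(_ j)|x _]; last by rewrite mxE -expr2 sqr_ge0.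
by rewrite mem_index_enum mxE -expr2 sqrf_eq0 => /(_ isT)/eqP.
Qed.

Lemma row_free_gram m n (M : 'M[R]_(m, n)) :
  row_free M -> M *m M^T \in unitmx.
Proof.
move=> Mfree; rewrite -row_free_unit -kermx_eq0; apply/eqP/(row_free_inj Mfree).
rewrite mul0mx; apply: mulmx_trmx_eq0.
by rewrite trmx_mul mulmxA -(mulmxA _ M) mulmx_ker mul0mx.
Qed.

Lemma moore_penrose_factor m n r (C : 'M[R]_(m, r)) (B : 'M[R]_(r, n)) :
  row_free C^T -> row_free B ->
  exists X, moore_penrose (C *m B) X.
Proof.
move=> Cfree Bfree; have BU := row_free_gram Bfree.
have CU : C^T *m C \in unitmx by have := row_free_gram Cfree; rewrite trmxK.
set G := invmx (B *m B^T); set H := invmx (C^T *m C).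
have BG : B *m B^T *m G = 1%:M by rewrite mulmxV.
have HC : H *m (C^T *m C) = 1%:M by rewrite mulVmx.
have MX : C *m B *m (B^T *m G *m H *m C^T) = C *m H *m C^T.
  by rewrite !mulmxA -(mulmxA C) -(mulmxA C) BG mulmx1.
have XM : B^T *m G *m H *m C^T *m (C *m B) = B^T *m G *m B.
  by rewrite -!mulmxA (mulmxA C^T) (mulmxA H) HC mul1mx.
have GT : G^T = G by rewrite trmx_inv trmx_mul trmxK.
have HT : H^T = H by rewrite trmx_inv trmx_mul trmxK.
exists (B^T *m G *m H *m C^T); split.
- by rewrite MX -!mulmxA (mulmxA C^T) (mulmxA H) HC mul1mx.
- by rewrite XM !mulmxA -(mulmxA (B^T *m G)) -(mulmxA _ (B *m B^T)) BG mulmx1.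
- by rewrite MX !trmx_mul trmxK HT mulmxA.
- by rewrite XM !trmx_mul trmxK GT mulmxA.
Qed.

Lemma moore_penroseP m n (M : 'M[R]_(m, n)) : moore_penrose M (mp_pinv M).
Proof.
have [] := @moore_penrose_factor _ _ _ (col_base M) (row_base M).
- by rewrite /row_free mxrank_tr; exact: col_base_full.
- exact: row_base_free.
- by rewrite mulmx_base => X MX; exact: (xgetPex 0 (ex_intro _ X MX)).
Qed.

Lemma norm2_has_sup m n (M : 'M[R]_(m, n)) :
  has_sup [set normF (M *m x) | x in [set x : 'cV[R]_n | normF x <= 1]].
Proof.
have normF0 a b : normF (0 : 'M[R]_(a, b)) = 0.
  rewrite /normF big1 ?sqrtr0// => i _; rewrite big1// => j _.
  by rewrite mxE expr0n.
split; first by exists (normF (M *m (0 : 'cV[R]_n))), 0; rewrite //= normF0.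
exists (Num.sqrt (\sum_i (\sum_j `|M i j|) ^+ 2)) => _ [x /= x1 <-].
rewrite ler_wsqrtr//; apply: ler_sum => i _; rewrite big_ord1.
rewrite -real_normK ?num_real// lerXn2r ?nnegrE ?sumr_ge0//.
rewrite mxE (le_trans (ler_norm_sum _ _ _))//; apply: ler_sum => j _.
rewrite normrM ler_piMr// -sqrtr_sqr; apply: le_trans x1; rewrite ler_wsqrtr//.
under eq_bigr do rewrite big_ord1.
by rewrite (bigD1 j)//= lerDl sumr_ge0// => k _; exact: sqr_ge0.
Qed.

End Norms.

Section RowSplitting.
Context {R : realType}.

Definition top_rows r n l (h : (r <= n)%N) (M : 'M[R]_(n, l)) : 'M[R]_(r, l) :=
  rowsub (fun i => cast_ord (subnKC h) (lshift (n - r) i)) M.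

Definition bottom_rows r n l (h : (r <= n)%N) (M : 'M[R]_(n, l)) :
    'M[R]_(n - r, l) :=
  rowsub (fun i => cast_ord (subnKC h) (rshift r i)) M.

Definition right_cols r m n (h : (r <= n)%N) (M : 'M[R]_(m, n)) :
    'M[R]_(m, n - r) :=
  colsub (fun j => cast_ord (subnKC h) (rshift r j)) M.

End RowSplitting.

Section SVD.
Context {R : realType}.

(* Singular values are numbered from 1: only sigma 1, ..., sigma n matter,
   and the 0-based diagonal position j holds sigma j.+1. *)
Definition is_svd m n (A U : 'M[R]_(m, n)) (sigma : nat -> R) (V : 'M[R]_n) :
    Prop :=
  [/\ U^T *m U = 1%:M, V^T *m V = 1%:M,
      A = U *m diag_mx (\row_(j < n) sigma j.+1) *m V^T,
      forall i, (1 <= i <= n)%N -> 0 <= sigma i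
    & forall i j, (1 <= i)%N -> (i <= j)%N -> (j <= n)%N -> sigma j <= sigma i].

(* U_0 Sigma_0 V_0^T with Sigma_0 = diag(sigma_(k+1), ..., sigma_n). *)
Definition svd_tail m n k (h : (k <= n)%N) (U : 'M[R]_(m, n))
    (sigma : nat -> R) (V : 'M[R]_n) : 'M[R]_(m, n) :=
  right_cols h U *m diag_mx (\row_(j < n - k) sigma (k + j).+1)
    *m (right_cols h V)^T.

End SVD.

Section CoRUTV.
Context {R : realType}.

Definition upper_triangular l (T : 'M[R]_l) : Prop :=
  forall i j : 'I_l, (j < i)%N -> T i j = 0.

Definition reduced_qr m l (C Q : 'M[R]_(m, l)) (T : 'M[R]_l) : Prop :=
  [/\ Q^T *m Q = 1%:M, upper_triangular T & C = Q *m T].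

Definition pivoted_qr l (D Q T S : 'M[R]_l) : Prop :=
  [/\ Q^T *m Q = 1%:M, upper_triangular T, is_perm_mx S & D = Q *m T *m S^T].

(* The common part of the two algorithms, from the sketches C1 and C2 on.
   QR factors are not unique (even up to signs when the sketch is
   rank-deficient), so the algorithm is a relation between inputs and
   outputs. *)
Definition utv_of_sketches m n l (A : 'M[R]_(m, n))
    (C1 : 'M[R]_(m, l)) (C2 : 'M[R]_(n, l))
    (U : 'M[R]_(m, l)) (T : 'M[R]_l) (V : 'M[R]_(n, l)) : Prop :=
  exists (Q1 : 'M[R]_(m, l)) (R1 : 'M[R]_l) (Q2 : 'M[R]_(n, l)) (R2 : 'M[R]_l)
         (Qt Rt Pt : 'M[R]_l),
    [/\ reduced_qr C1 Q1 R1, reduced_qr C2 Q2 R2,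
        pivoted_qr (Q1^T *m A *m Q2) Qt Rt Pt
      & [/\ U = Q1 *m Qt, T = Rt & V = Q2 *m Pt]].

Definition cor_utv m n l (A : 'M[R]_(m, n)) (Psi : 'M[R]_(n, l)) U T V : Prop :=
  let C1 := A *m Psi in
  let C2 := A^T *m C1 in
  utv_of_sketches A C1 C2 U T V.

Definition power_step m n l (A : 'M[R]_(m, n))
    (C : 'M[R]_(m, l) * 'M[R]_(n, l)) : 'M[R]_(m, l) * 'M[R]_(n, l) :=
  let C1 := A *m C.2 in (C1, A^T *m C1).

(* The initial first component 0 is overwritten by the first step. *)
Definition cor_utv_power m n l (q : nat) (A : 'M[R]_(m, n))
    (Psi : 'M[R]_(n, l)) U T V : Prop :=
  let C := iter q.+1 (power_step A) (0, Psi) in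
  utv_of_sketches A C.1 C.2 U T V.

End CoRUTV.

Section GaussianMatrix.
Context {R : realType} d (Omega : measurableType d) (P : probability Omega R).

Definition rv_mx n l (X : 'I_n -> 'I_l -> {RV P >-> R}) (w : Omega) :
    'M[R]_(n, l) :=
  \matrix_(i, j) X i j w.

(* The product rule is required for the full family only; for a subfamily take
   B i j = setT at the other entries. *)
Definition iid_standard_gaussian n l (X : 'I_n -> 'I_l -> {RV P >-> R}) : Prop :=
  (forall i j (B : set R), measurable B ->
     distribution P (X i j) B = normal_prob 0 1 B) /\
  (forall B : 'I_n -> 'I_l -> set R, (forall i j, measurable (B i j)) ->
     P [set w | forall i j, B i j (X i j w)] =
     (\prod_(i < n) \prod_(j < l) P (X i j @^-1` B i j))%E).

End GaussianMatrix.

Section ErrorBound.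
Context {R : realType}.

Definition gaussian_terms (alpha beta eta tau g2 g1 : R) : R :=
  Num.sqrt (alpha ^+ 2 * g2 ^+ 2 * g1 ^+ 2
            / (1 + beta ^+ 2 * g2 ^+ 2 * g1 ^+ 2)) +
  Num.sqrt (eta ^+ 2 * g2 ^+ 2 * g1 ^+ 2
            / (1 + tau ^+ 2 * g2 ^+ 2 * g1 ^+ 2)).

(* Here s1, sk, s stand for sigma_1, sigma_k, sigma_(l-p+1). *)
Definition alpha_basic (k : nat) (sk s : R) := Num.sqrt k%:R * (s ^+ 2 / sk).
Definition beta_basic (s1 sk s : R) := s ^+ 2 / (s1 * sk).
Definition eta_basic (k : nat) (s : R) := Num.sqrt k%:R * s.
Definition tau_basic (s1 s : R) := s / s1.

(* eta_power and tau_power are the quotients (sk / s) * alpha_power and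
   (sk / s) * beta_power with one factor s cancelled, so that they keep their
   meaning when s = 0. *)
Definition alpha_power (q k : nat) (sk s : R) :=
  Num.sqrt k%:R * (s ^+ 2 / sk) * (s / sk) ^+ (2 * q).
Definition beta_power (q : nat) (s1 sk s : R) :=
  s ^+ 2 / (s1 * sk) * (s / sk) ^+ (2 * q).
Definition eta_power (q k : nat) (sk s : R) :=
  Num.sqrt k%:R * s * (s / sk) ^+ (2 * q).
Definition tau_power (q : nat) (s1 sk s : R) := s / s1 * (s / sk) ^+ (2 * q).

Lemma eta_powerE q k (sk s : R) : sk != 0 -> s != 0 ->
  eta_power q k sk s = sk / s * alpha_power q k sk s.
Proof.
move=> sk0 s0; rewrite /eta_power /alpha_power.
by move: (_ ^+ (2 * q)) => e; field; rewrite sk0 s0.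
Qed.

Lemma tau_powerE q (s1 sk s : R) : s1 != 0 -> sk != 0 -> s != 0 ->
  tau_power q s1 sk s = sk / s * beta_power q s1 sk s.
Proof.
move=> s10 sk0 s0; rewrite /tau_power /beta_power.
by move: (_ ^+ (2 * q)) => e; field; rewrite s10 sk0 s0.
Qed.

End ErrorBound.

(* Main.v *)
From HB Require Import structures.
Require Import Defs.
From mathcomp Require Import all_boot all_order all_algebra.
From mathcomp Require Import all_classical all_reals all_analysis.
From mathcomp Require Import perm measurable_realfun ring.

(** Write [P1 = Q1 *m Q1^T] and [P2 = Q2 *m Q2^T] for the projections onto the
    ranges computed by the two QR factorizations. The pivoted QR factorization
    cancels out, and the output is [P1 *m A *m P2]. Let [A = Ak + A0] be the
    splitting after the [k]-th singular value.

    In the Frobenius norm, [P1 *m A *m P2] is the best approximation of [A] of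
    the form [P1 *m X *m P2] (normF_proj_optimal); comparing with [X = Ak]
    bounds the error by the norms of [A0], [(1 - P1) *m Ak] and
    [Ak *m (1 - P2)] (error_split_F).

    Each residual is a sum over the first [k] singular vectors, and each is
    estimated by exhibiting one vector of the sketched range close to
    [sigma_i u_i] (residual_column, residual_head). The right inverse of the
    top block of [VA^T *m Psi] provides a vector of the range whose only
    component among the leading singular directions is along [u_i]; the ratio
    of its trailing part to its leading part is governed by
    [sigma_(l-p+1)^(j+1) / sigma_k^j], where [j + 1] is the power of the
    singular values in the sketch. Optimizing over the length of that vector
    gives the expression [g^2 / (1 + g^2 / sigma_1^2)]: the term with eta
    and tau comes from the left sketch, the one with alpha and beta from the
    right sketch, which carries one more power.

    In the spectral norm [P1 *m A *m P2] is not a best approximation. Instead,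
    the right sketch is [A^T] times the left one, so that
    [P1 *m A *m P2 = P1 *m A] as soon as the left sketch has the rank that its
    size and [A] allow (sketch_range). The error is then [(1 - P1) *m A], and
    the residual of [A0] is at most the norm of [A0] because [1 - P1] is a
    contraction.

    The rank condition holds almost surely (gaussian_sketch_rank): its failure
    forces a determinant, affine in each Gaussian entry and not identically
    zero, to vanish. Such a function of independent atomless variables is
    almost surely nonzero (multiaffine_neq0_ae), by adding one variable at a
    time and using that it is independent of the previous ones. *)

Set Implicit Arguments.
Unset Strict Implicit.
Unset Printing Implicit Defensive.

Import Order.TTheory GRing.Theory Num.Theory.
Local Open Scope classical_set_scope.
Local Open Scope ring_scope.

(** * Multi-affine functions of independent variables *)

Section Independence.
Context (R : realType) d (Omega : measurableType d) (P : probability Omega R).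

(** The joint law of the pair is the product of the two laws, so the measure of
    [D] is the integral of the measures of its sections. *)
Lemma independent_section_null d' (T : measurableType d')
    (X : Omega -> R) (Y : Omega -> T) (D : set (T * R)) :
  measurable_fun setT X -> measurable_fun setT Y -> measurable D ->
  (forall A B, measurable A -> measurable B ->
     P (Y @^-1` A `&` X @^-1` B) = (P (Y @^-1` A) * P (X @^-1` B))%E) ->
  (forall y, P (X @^-1` xsection D y) = 0%E) ->
  {ae P, forall w, ~ D (Y w, X w)}.
Proof.
move=> mX mY mD indep secD0.
pose X' : {mfun Omega >-> R} := HB.pack X (isMeasurableFun.Build _ _ _ _ _ mX).
pose Y' : {mfun Omega >-> T} := HB.pack Y (isMeasurableFun.Build _ _ _ _ _ mY).
pose YX : {mfun Omega >-> (T * R)%type} :=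
  HB.pack (fun w => (Y w, X w))
    (isMeasurableFun.Build _ _ _ _ _ (measurable_fun_pair mY mX)).
have XYE := @product_measure_unique _ _ _ _ _
  (distribution P Y') (distribution P X') (distribution P YX) indep.
exists (YX @^-1` D); split.
- by rewrite -[X in measurable X]setTI; exact: measurable_funPT.
- rewrite -[LHS]/(distribution P YX D) -(XYE _ mD).
  by rewrite /product_measure1/=; apply: integral0_eq => y _; exact: secD0.
- by move=> w /contrapT.
Qed.

Context (I : finType) (X : I -> {RV P >-> R})
  (indepX : forall B : I -> set R, (forall i, measurable (B i)) ->
    P [set w | forall i, B i (X i w)] = (\prod_i P (X i @^-1` B i))%E).

(** A pi-system generating the events that do not depend on [X i0]. *)
Definition cylinders_off (i0 : I) : set (set Omega) :=
  [set E | exists B : I -> set R, [/\ forall i, measurable (B i),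
     B i0 = setT & E = [set w | forall i, B i (X i w)]]].

Lemma measurable_cylinder (B : I -> set R) : (forall i, measurable (B i)) ->
  measurable [set w | forall i, B i (X i w)].
Proof.
move=> mB.
have -> : [set w | forall i, B i (X i w)] =
    \big[setI/setT]_(i <- index_enum I) (X i @^-1` B i).
  rewrite -bigcap_seq; apply/seteqP; split=> w /= h i.
    by move=> _; exact: h.
  by apply: (h i); rewrite /= mem_index_enum.
apply: bigsetI_measurable => i _; rewrite -[X in measurable X]setTI.
exact: measurable_funPT.
Qed.

Lemma measurable_off (i0 i : I) : i != i0 ->
  measurable_fun setT (X i : g_sigma_algebraType (cylinders_off i0) -> R).
Proof.
move=> ii0 _ B mB; rewrite setTI; apply: sub_sigma_algebra.
exists (fun j => if j == i then B else setT); split.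
- by move=> j; case: ifP.
- by rewrite eq_sym (negbTE ii0).
- apply/seteqP; split=> w /=; last by move=> /(_ i); rewrite eqxx.
  by move=> Bw j; case: eqP => // ->.
Qed.

(** Both sides are finite measures in [D], and they agree on the pi-system of
    cylinders by the product rule applied to the cylinder [D] with the
    constraint [B] added at coordinate [i0]. *)
Lemma independent_off (i0 : I) (D : set Omega) (B : set R) :
  <<s cylinders_off i0 >> D -> measurable B ->
  P (D `&` X i0 @^-1` B) = (P D * P (X i0 @^-1` B))%E.
Proof.
move=> sD mB.
have mXB : measurable (X i0 @^-1` B).
  by rewrite -[X in measurable X]setTI; exact: measurable_funPT.
have c0 : 0 <= fine (P (X i0 @^-1` B)) by rewrite fine_ge0.
have cE : P (X i0 @^-1` B) = (fine (P (X i0 @^-1` B)))%:E.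
  by rewrite fineK// fin_num_measure.
have sub : cylinders_off i0 `<=` measurable.
  by move=> _ [C [mC _ ->]]; exact: measurable_cylinder.
have := @g_sigma_algebra_measure_unique _ _ _ (cylinders_off i0) sub (fun=> setT)
  _ _ (mrestr P mXB) (mscale (NngNum c0) P).
rewrite /= /mrestr /mscale /= -cE => /(_ _ _ _ _ _ D sD).
rewrite (muleC (P D)); apply.
- move=> _; exists (fun=> setT); split=> //.
  by apply/seteqP; split.
- by apply/seteqP; split=> // w _; exists 0.
- move=> _ _ [C [mC Ci ->]] [C' [mC' Ci' ->]].
  exists (fun i => C i `&` C' i); split=> [i||].
  + exact: measurableI.
  + by rewrite /= Ci Ci' setTI.
  + apply/seteqP; split=> w /=; first by move=> [h h'] i.
    by move=> h; split=> i; case: (h i).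
- move=> _ [C [mC Ci ->]].
  have mC' i : measurable (if i == i0 then B else C i) by case: ifP.
  have -> : P [set w | forall i, C i (X i w)] =
      (\prod_(i | i != i0) P (X i @^-1` C i))%E.
    by rewrite indepX// (bigD1 i0)//= Ci preimage_setT probability_setT mul1e.
  have -> : (P (X i0 @^-1` B) * \prod_(i | i != i0) P (X i @^-1` C i))%E =
      P [set w | forall i, (if i == i0 then B else C i) (X i w)].
    rewrite (indepX mC') [RHS](bigD1 i0)//= eqxx; congr (_ * _)%E.
    by apply: eq_bigr => i /negbTE ->.
  congr (P _); apply/seteqP; split=> w /=.
    by move=> [h hB] i; case: eqP => // ->.
  move=> h; split; last by have := h i0; rewrite eqxx.
  by move=> i; have := h i; case: eqP => // -> _; rewrite Ci.
- by move=> _; rewrite ltey_eq setTI fin_num_measure.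
Qed.

Context (atomlessX : forall i x, P (X i @^-1` [set x]) = 0%E).

Definition update (x : I -> R) (i : I) (t : R) : I -> R :=
  fun j => if j == i then t else x j.

(** Randomize the coordinates of a point where [f] does not vanish one at a
    time. Once some coordinates are random, [f] is [b + t * a] in the next
    coordinate [t], with [a] and [b] independent of [X i]. Almost surely [a]
    and [b] are not both zero, since they give a nonzero value at the old
    coordinate; hence at most one value of [X i] makes [f] vanish, and that
    value has probability zero. *)
Lemma multiaffine_neq0_ae (f : (I -> R) -> R) :
  (forall x i t, f (update x i t) = f (update x i 0) +
     t * (f (update x i 1) - f (update x i 0))) ->
  (forall d' (T : measurableType d') (Z : I -> T -> R),
     (forall i, measurable_fun setT (Z i)) ->
     measurable_fun setT (fun w => f (fun i => Z i w))) ->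
  (exists y, f y != 0) ->
  {ae P, forall w, f (fun i => X i w) != 0}.
Proof.
move=> faff fmeas [y fy].
pose mix (s : seq I) w : I -> R := fun i => if i \in s then X i w else y i.
suff H s : {ae P, forall w, f (mix s w) != 0}.
  apply: filterS (H (enum I)) => w; congr (f _ != 0).
  by apply/funext => i; rewrite /mix mem_enum.
elim: s => [|i s IH].
  exact/aeW.
have [si|si] := boolP (i \in s).
  apply: filterS IH => w; congr (f _ != 0).
  by apply/funext => j; rewrite /mix inE; case: eqP => // ->; rewrite si.
pose b w := f (update (mix s w) i 0).
pose a w := f (update (mix s w) i 1) - b w.
have mixE w : f (mix (i :: s) w) = b w + X i w * a w.
  rewrite -faff; congr f; apply/funext => j; rewrite /update/mix inE.
  by case: eqP => // ->.
have mixE0 w : f (mix s w) = b w + y i * a w.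
  rewrite -faff; congr f; apply/funext => j; rewrite /update/mix.
  by case: eqP => // ->; rewrite (negbTE si).
(* the sample space, remembering only the coordinates other than [i] *)
pose T := g_sigma_algebraType (cylinders_off i).
have mupdate t :
    measurable_fun setT ((fun w => f (update (mix s w) i t)) : T -> R).
  apply: (fmeas _ T (fun j w => update (mix s w) i t j)) => j; rewrite /update/mix.
  case: eqP => [_|/eqP ji]; first exact: measurable_cst.
  by case: (j \in s); [exact: measurable_off|exact: measurable_cst].
have mb : measurable_fun setT (b : T -> R) by exact: mupdate.
have ma : measurable_fun setT (a : T -> R) by exact: measurable_funB.
pose Y w := (b w, a w).
have mY : measurable_fun setT (Y : T -> _) by exact: measurable_fun_pair.
have sub A : measurable A -> <<s cylinders_off i >> (Y @^-1` A).
  by move=> mA; have := mY measurableT A mA; rewrite setTI.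
have submeas D : <<s cylinders_off i >> D -> measurable D.
  apply: smallest_sub; first exact: sigma_algebra_measurable.
  by move=> _ [C [mC _ ->]]; exact: measurable_cylinder.
pose t (z : R * R * R) := (z.1.1 + z.2 * z.1.2 == 0) && ~~ (z.1.2 == 0).
have mt : measurable_fun setT t.
  have m1 : measurable_fun setT (fun z : R * R * R => z.1.1).
    exact: measurableT_comp.
  have m2 : measurable_fun setT (fun z : R * R * R => z.1.2).
    exact: measurableT_comp.
  apply: measurable_and; last apply: measurable_neg.
    apply: measurable_fun_eqr => //; apply: measurable_funD => //.
    exact: measurable_funM.
  exact: measurable_fun_eqr.
have : {ae P, forall w, ~ (t @^-1` [set true]) (Y w, X i w)}.
  apply: independent_section_null => //.
  - by move=> _ A mA; rewrite setTI; apply: submeas; exact: sub.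
  - by rewrite -[X in measurable X]setTI; exact: mt.
  - by move=> A B mA mB; apply: independent_off => //; exact: sub.
  - move=> [b0 a0]; apply/eqP; rewrite eq_le measure_ge0 andbT.
    rewrite -(atomlessX i (- b0 / a0)) le_measure ?inE//.
    + apply: measurable_funPTI.
      apply: measurable_xsection.
      by rewrite -[X in measurable X]setTI; exact: mt.
    + move=> w; rewrite /= /xsection/= inE /t/= => /andP[/eqP h a0N].
      apply: (mulIf a0N); rewrite mulfVK//; apply/eqP.
      by rewrite -addr_eq0 addrC h.
apply: filterS2 IH => w; rewrite mixE mixE0 /t/=.
have [->|a0] := eqVneq (a w) 0; first by rewrite !mulr0.
by move=> _ /negP; rewrite andbT.
Qed.

End Independence.

(** * Rank of Gaussian sketches *)

Section GenericRank.
Context (R : realType).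

Lemma det_col_affine r (N N0 N1 : 'M[R]_r) (j0 : 'I_r) (t : R) :
  (forall i j, j != j0 -> N i j = N0 i j /\ N1 i j = N0 i j) ->
  (forall i, N i j0 = N0 i j0 + t * (N1 i j0 - N0 i j0)) ->
  \det N = \det N0 + t * (\det N1 - \det N0).
Proof.
move=> Noff Non.
rewrite -(det_tr N) -(det_tr N0) -(det_tr N1).
rewrite (@determinant_multilinear _ _ N^T N0^T N1^T j0 (1 - t) t); first by ring.
- by apply/rowP => i; rewrite !mxE Non; ring.
- by apply/matrixP => j i; rewrite !mxE (Noff _ _ _).1// eq_sym neq_lift.
- apply/matrixP => j i; rewrite !mxE.
  by rewrite (Noff i (lift j0 j) _).1 ?(Noff i (lift j0 j) _).2// eq_sym neq_lift.
Qed.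

Context d (Omega : measurableType d) (P : probability Omega R).

Lemma iid_gaussian_atomless n l (Psi : 'I_n -> 'I_l -> {RV P >-> R}) i j x :
  iid_standard_gaussian Psi -> P (Psi i j @^-1` [set x]) = 0%E.
Proof.
move=> [law _]; have := law i j _ (measurable_set1 x).
rewrite /distribution /pushforward /= => ->.
have /null_content_dominatesP := @normal_prob_dominates R 0 1.
by apply; [exact: measurable_set1|exact: lebesgue_measure_set1].
Qed.

(** A Gaussian sketch of [M] almost surely keeps as much rank as its [l]
    columns can hold. With [r] this rank and [B] made of [r] independent
    combinations of the rows of [M], the determinant of [B] times the first [r]
    columns of the test matrix is affine in each entry; it equals 1 when these
    columns form a right inverse of [B], so it is almost surely nonzero. *)
Lemma gaussian_sketch_rank m n l (M : 'M[R]_(m, n))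
    (Psi : 'I_n -> 'I_l -> {RV P >-> R}) : iid_standard_gaussian Psi ->
  {ae P, forall w, (minn l (\rank M) <= \rank (M *m rv_mx Psi w))%N}.
Proof.
move=> gPsi; set r := minn l (\rank M).
have rl : (r <= l)%N by exact: geq_minl.
pose B := (pid_mx r : 'M[R]_(r, \rank M)) *m row_base M.
have Bfree : row_free B.
  by rewrite /row_free mxrankMfree ?row_base_free// rank_pid_mx// geq_minr.
have /submxP[K BE] : (B <= M)%MS by rewrite -(eq_row_base M) submxMl.
pose mat (x : 'I_n * 'I_l -> R) : 'M[R]_(n, r) :=
  \matrix_(i, j) x (i, widen_ord rl j).
pose f x := \det (B *m mat x).
have faff x i t : f (update x i t) = f (update x i 0) +
     t * (f (update x i 1) - f (update x i 0)).
  case: i => i j; have [jr|rj] := ltnP j r; last first.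
    suff E u v : f (update x (i, j) u) = f (update x (i, j) v).
      by rewrite (E 1 0) (E t 0); ring.
    congr (\det (B *m _)); apply/matrixP => a b; rewrite !mxE /update.
    case: eqP => // -[_ jE]; have := ltn_ord b.
    by rewrite ltnNge -[X in (_ <= X)%N]/(val (widen_ord rl b)) jE rj.
  apply: (@det_col_affine _ _ _ _ (Ordinal jr)) => [a b bj|a]; rewrite !mxE.
    split; apply: eq_bigr => c _; rewrite !mxE /update; case: eqP => // -[_ jE];
    by case/eqP: bj; apply: val_inj; exact: (congr1 val jE).
  rewrite -sumrB mulr_sumr -big_split/=; apply: eq_bigr => c _; rewrite !mxE /update.
  have -> : widen_ord rl (Ordinal jr) = j by exact: val_inj.
  by case: eqP => _; ring.
have fmeas d' (T : measurableType d') (Z : 'I_n * 'I_l -> T -> R) :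
    (forall i, measurable_fun setT (Z i)) ->
    measurable_fun setT (fun w => f (fun i => Z i w)).
  move=> mZ; apply: measurable_sum => s; apply: measurable_funM => //.
  apply: measurable_prod => i _.
  have -> : (fun w => (B *m mat (fun k => Z k w)) i (s i)) =
      (fun w => \sum_a B i a * Z (a, widen_ord rl (s i)) w).
    by apply/funext => w; rewrite mxE; apply: eq_bigr => a _;
      rewrite [mat _ _ _]mxE.
  by apply: measurable_sum => a; exact: measurable_funM.
(* the default 0 fills the columns beyond the first [r] *)
have fneq0 : exists y, f y != 0.
  exists (fun ij => if insub (val ij.2) is Some j then pinvmx B ij.1 j else 0).
  rewrite /f (_ : mat _ = pinvmx B) ?mulmxVp// ?det1 ?oner_eq0//.
  apply/matrixP => i j; rewrite [LHS]mxE /=; case: insubP => /= [j' _ jj'|].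
    by congr (pinvmx B _ _); apply: val_inj.
  by rewrite ltn_ord.
pose X (ij : 'I_n * 'I_l) := Psi ij.1 ij.2.
have indepX (C : 'I_n * 'I_l -> set R) : (forall i, measurable (C i)) ->
    P [set w | forall i, C i (X i w)] = (\prod_i P (X i @^-1` C i))%E.
  move=> mC; have := gPsi.2 (fun i j => C (i, j)) (fun i j => mC (i, j)).
  rewrite (pair_big predT predT)/= => E.
  transitivity (P [set w | forall i j, C (i, j) (Psi i j w)]).
    congr (P _); apply/seteqP; split=> w /= h => [i j|[i j]]; last exact: h.
    exact: (h (i, j)).
  by rewrite E; apply: eq_bigr => -[i j] _.
have atomX i x : P (X i @^-1` [set x]) = 0%E by exact: iid_gaussian_atomless.
apply: filterS (multiaffine_neq0_ae indepX atomX faff fmeas fneq0) => w.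
rewrite /f -unitfE -unitmxE -row_free_unit => /eqnP rkE.
have matE : mat (fun i => X i w) = rv_mx Psi w *m colsub (widen_ord rl) 1%:M.
  by rewrite mulmx_colsub mulmx1; apply/matrixP => i j; rewrite !mxE.
rewrite -{1}rkE matE BE mulmxA -(mulmxA K) (leq_trans (mxrankM_maxl _ _))//.
exact: mxrankM_maxr.
Qed.

End GenericRank.

(** * Frobenius norm, spectral norm and projections *)

Section Norms.
Context (R : realType).

Lemma normF_sqr m n (M : 'M[R]_(m, n)) :
  normF M ^+ 2 = \sum_i \sum_j M i j ^+ 2.
Proof.
by rewrite sqr_sqrtr// sumr_ge0// => i _; rewrite sumr_ge0// => j _; exact: sqr_ge0.
Qed.

Lemma normF_ge0 m n (M : 'M[R]_(m, n)) : 0 <= normF M.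
Proof. exact: sqrtr_ge0. Qed.

Lemma normF_le m n m' n' (M : 'M[R]_(m, n)) (N : 'M[R]_(m', n')) :
  normF M ^+ 2 <= normF N ^+ 2 -> normF M <= normF N.
Proof. by rewrite ler_pXn2r// nnegrE normF_ge0. Qed.

Lemma normF_sqr_trace m n (M : 'M[R]_(m, n)) : normF M ^+ 2 = \tr (M^T *m M).
Proof.
rewrite normF_sqr exchange_big/=; apply: eq_bigr => j _.
by rewrite mxE; apply: eq_bigr => i _; rewrite mxE expr2.
Qed.

Lemma normF_tr m n (M : 'M[R]_(m, n)) : normF M^T = normF M.
Proof.
rewrite /normF exchange_big/=; congr Num.sqrt.
by apply: eq_bigr => i _; apply: eq_bigr => j _; rewrite mxE.
Qed.

Lemma normF0 m n : normF (0 : 'M[R]_(m, n)) = 0.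
Proof.
by rewrite /normF big1 ?sqrtr0// => i _; rewrite big1// => j _; rewrite mxE expr0n.
Qed.

Lemma normF_eq0 m n (M : 'M[R]_(m, n)) : normF M = 0 -> M = 0.
Proof.
move=> M0; apply/matrixP => i j; rewrite mxE; apply/eqP; rewrite -sqrf_eq0.
have /eqP := normF_sqr M; rewrite M0 expr0n/= eq_sym psumr_eq0; last first.
  by move=> a _; rewrite sumr_ge0// => b _; exact: sqr_ge0.
move=> /allP/(_ i (mem_index_enum _)); rewrite psumr_eq0; last first.
  by move=> b _; exact: sqr_ge0.
by move=> /allP/(_ j (mem_index_enum _)).
Qed.

Lemma normFZ m n a (M : 'M[R]_(m, n)) : normF (a *: M) = `|a| * normF M.
Proof.
rewrite -sqrtr_sqr -sqrtrM ?sqr_ge0//; congr Num.sqrt.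
rewrite mulr_sumr; apply: eq_bigr => i _; rewrite mulr_sumr.
by apply: eq_bigr => j _; rewrite mxE exprMn.
Qed.

Lemma normFN m n (M : 'M[R]_(m, n)) : normF (- M) = normF M.
Proof. by rewrite -scaleN1r normFZ normrN1 mul1r. Qed.

Lemma normF_sqrD m n (M N : 'M[R]_(m, n)) :
  normF (M + N) ^+ 2 = normF M ^+ 2 + normF N ^+ 2 + (\tr (M^T *m N)) *+ 2.
Proof.
rewrite !normF_sqr_trace [(M + N)^T]linearD/= mulmxDl !mulmxDr !mxtraceD.
have -> : \tr (N^T *m M) = \tr (M^T *m N).
  by rewrite -mxtrace_tr trmx_mul trmxK.
by rewrite mulr2n; ring.
Qed.

Lemma trace_le_normF m n (M N : 'M[R]_(m, n)) :
  \tr (M^T *m N) <= normF M * normF N.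
Proof.
have [M0|M0] := eqVneq (normF M) 0.
  by rewrite (normF_eq0 M0) trmx0 mul0mx mxtrace0 normF0 mul0r.
have [N0|N0] := eqVneq (normF N) 0.
  by rewrite (normF_eq0 N0) mulmx0 mxtrace0 normF0 mulr0.
have Mgt : 0 < normF M by rewrite lt_def M0 normF_ge0.
have Ngt : 0 < normF N by rewrite lt_def N0 normF_ge0.
have := sqr_ge0 (normF (normF N *: M + (- normF M) *: N)).
rewrite normF_sqrD !normFZ normrN !ger0_norm ?normF_ge0//.
rewrite [(_ *: M)^T]linearZ/= -scalemxAl -scalemxAr !mxtraceZ.
set t := \tr _; set a := normF M in Mgt *; set b := normF N in Ngt *.
have -> : (b * a) ^+ 2 + (a * b) ^+ 2 + (b * (- a * t)) *+ 2 =
  (a * b) * ((a * b - t) *+ 2) by rewrite !mulr2n; ring.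
by rewrite pmulr_rge0 ?mulr_gt0// pmulrn_lge0// subr_ge0.
Qed.

Lemma normFD m n (M N : 'M[R]_(m, n)) : normF (M + N) <= normF M + normF N.
Proof.
rewrite -(@ler_pXn2r _ 2)// ?nnegrE ?addr_ge0 ?normF_ge0//.
rewrite normF_sqrD sqrrD addrAC lerD2r lerD2l.
by rewrite lerMn2r trace_le_normF orbT.
Qed.

Lemma normF_isometry m n l (W : 'M[R]_(m, n)) (M : 'M[R]_(n, l)) :
  W^T *m W = 1%:M -> normF (W *m M) = normF M.
Proof.
move=> WW; apply: (@pexpIrn _ 2); rewrite ?nnegrE ?normF_ge0//.
by rewrite !normF_sqr_trace trmx_mul mulmxA -(mulmxA M^T) WW mulmx1.
Qed.

Lemma normF_coisometry m n l (W : 'M[R]_(m, n)) (M : 'M[R]_(l, n)) :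
  W^T *m W = 1%:M -> normF (M *m W^T) = normF M.
Proof. by move=> WW; rewrite -normF_tr trmx_mul trmxK normF_isometry// normF_tr. Qed.

Lemma normF_sqr_cols m n (M : 'M[R]_(m, n)) :
  normF M ^+ 2 = \sum_j normF (col j M) ^+ 2.
Proof.
rewrite normF_sqr exchange_big/=; apply: eq_bigr => j _.
by rewrite normF_sqr; apply: eq_bigr => i _; rewrite big_ord1 mxE.
Qed.

Lemma normF_sqr_rows n r (h : (r <= n)%N) (x : 'cV[R]_n) :
  normF x ^+ 2 = normF (top_rows h x) ^+ 2 + normF (bottom_rows h x) ^+ 2.
Proof.
rewrite !normF_sqr (reindex (cast_ord (subnKC h)))/=; last first.
  by exists (cast_ord (esym (subnKC h))) => i _; rewrite ?cast_ordK ?cast_ordKV.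
rewrite big_split_ord/=; congr (_ + _); apply: eq_bigr => i _;
by apply: eq_bigr => j _; rewrite mxE.
Qed.

Definition orthogonal_projection n (P : 'M[R]_n) := P^T = P /\ P *m P = P.

Lemma orthogonal_projection_range n l (Q : 'M[R]_(n, l)) :
  Q^T *m Q = 1%:M -> orthogonal_projection (Q *m Q^T).
Proof.
by move=> QQ; split; rewrite ?trmx_mul ?trmxK// mulmxA -(mulmxA Q) QQ mulmx1.
Qed.

Lemma orthogonal_projection1 n : orthogonal_projection (1%:M : 'M[R]_n).
Proof. by split; rewrite ?trmx1 ?mulmx1. Qed.

(** Pythagoras: the compression of [Z] and its residual are orthogonal for the
    trace inner product. *)
Lemma normF_sqr_projection m n (P : 'M[R]_m) (P' : 'M[R]_n) (Z : 'M[R]_(m, n)) :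
  orthogonal_projection P -> orthogonal_projection P' ->
  normF Z ^+ 2 =
    normF (P *m Z *m P') ^+ 2 + normF (Z - P *m Z *m P') ^+ 2.
Proof.
move=> [PT PP] [PT' PP'].
have {1}-> : Z = P *m Z *m P' + (Z - P *m Z *m P') by rewrite addrC subrK.
rewrite [LHS]normF_sqrD.
suff -> : \tr ((P *m Z *m P')^T *m (Z - P *m Z *m P')) = 0 by rewrite mul0rn addr0.
rewrite !trmx_mul PT PT' mulmxBr linearB/=; apply/eqP; rewrite subr_eq0; apply/eqP.
rewrite -[in LHS]PP' -!mulmxA [LHS]mxtrace_mulC !mulmxA.
by rewrite -(mulmxA _ P P) PP.
Qed.

Lemma normF_projection m n (P : 'M[R]_m) (P' : 'M[R]_n) (Z : 'M[R]_(m, n)) :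
  orthogonal_projection P -> orthogonal_projection P' ->
  normF (P *m Z *m P') <= normF Z /\ normF (Z - P *m Z *m P') <= normF Z.
Proof.
move=> pP pP'; split; apply: normF_le;
  rewrite (normF_sqr_projection Z pP pP') ?lerDl ?lerDr; exact: sqr_ge0.
Qed.

Lemma normF_left_projection m n (P : 'M[R]_m) (Z : 'M[R]_(m, n)) :
  orthogonal_projection P ->
  normF (P *m Z) <= normF Z /\ normF ((1%:M - P) *m Z) <= normF Z.
Proof.
move=> pP; have := normF_projection Z pP (orthogonal_projection1 n).
by rewrite mulmx1 mulmxBl mul1mx.
Qed.

(** The compression of [Z] is its best Frobenius approximation among all
    compressions: the left-hand side is the residual of the matrix on the
    right. This has no analogue for the spectral norm. *)
Lemma normF_proj_optimal m n (P : 'M[R]_m) (P' : 'M[R]_n) (Z X : 'M[R]_(m, n)) :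
  orthogonal_projection P -> orthogonal_projection P' ->
  normF (Z - P *m Z *m P') <= normF (Z - P *m X *m P').
Proof.
move=> pP pP'; have [_] := normF_projection (Z - P *m X *m P') pP pP'.
have [_ PP] := pP; have [_ PP'] := pP'.
rewrite mulmxBr mulmxBl !mulmxA PP -(mulmxA _ P') PP'.
by rewrite opprB addrA addrNK.
Qed.

Lemma normF_le_norm2 m n (M : 'M[R]_(m, n)) (x : 'cV[R]_n) :
  normF (M *m x) <= norm2 M * normF x.
Proof.
have [x0|x0] := eqVneq (normF x) 0.
  by rewrite (normF_eq0 x0) mulmx0 !normF0 mulr0.
have xgt : 0 < normF x by rewrite lt_def x0 normF_ge0.
rewrite -ler_pdivrMr//.
have -> : normF (M *m x) / normF x = normF (M *m ((normF x)^-1 *: x)).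
  by rewrite -scalemxAr normFZ ger0_norm ?invr_ge0 ?normF_ge0// mulrC.
apply: sup_upper_bound; first exact: norm2_has_sup.
exists ((normF x)^-1 *: x) => //=.
by rewrite normFZ ger0_norm ?invr_ge0 ?normF_ge0// mulVf.
Qed.

Lemma norm2_le m n (M : 'M[R]_(m, n)) c :
  (forall x : 'cV[R]_n, normF x <= 1 -> normF (M *m x) <= c) -> norm2 M <= c.
Proof.
move=> Mc; apply: ge_sup; first by have [] := norm2_has_sup M.
by move=> _ [x /= x1 <-]; exact: Mc.
Qed.

Lemma norm2_ge0 m n (M : 'M[R]_(m, n)) : 0 <= norm2 M.
Proof.
apply: sup_upper_bound; first exact: norm2_has_sup.
by exists 0; rewrite /= ?mulmx0 normF0 ?ler01.
Qed.

Lemma normF_mulmx_col m n (M : 'M[R]_(m, n)) (x : 'cV[R]_n) :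
  normF (M *m x) <= normF M * normF x.
Proof.
rewrite -(@ler_pXn2r _ 2)// ?nnegrE ?mulr_ge0 ?normF_ge0//.
rewrite exprMn [leLHS]normF_sqr [in leRHS]normF_sqr mulr_suml.
apply: ler_sum => i _; rewrite big_ord1 mxE.
have rowE : (\sum_j M i j * x j 0) = \tr (((row i M)^T)^T *m x).
  by rewrite trmxK /mxtrace big_ord1 mxE; apply: eq_bigr => j _; rewrite mxE.
have rownorm : \sum_j M i j ^+ 2 = normF (row i M)^T ^+ 2.
  by rewrite normF_tr normF_sqr big_ord1; apply: eq_bigr => j _; rewrite mxE.
rewrite rownorm -exprMn rowE -real_normK ?num_real//.
rewrite ler_pXn2r ?nnegrE ?mulr_ge0 ?normF_ge0// ler_norml trace_le_normF andbT.
rewrite lerNl; have := trace_le_normF (row i M)^T (- x).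
by rewrite mulmxN normFN (raddfN (@mxtrace R 1)).
Qed.

Lemma norm2_le_normF m n (M : 'M[R]_(m, n)) : norm2 M <= normF M.
Proof.
apply: norm2_le => x x1; rewrite (le_trans (normF_mulmx_col _ _))//.
by rewrite ler_piMr// normF_ge0.
Qed.

Lemma norm2D m n (M N : 'M[R]_(m, n)) : norm2 (M + N) <= norm2 M + norm2 N.
Proof.
apply: norm2_le => x x1; rewrite mulmxDl (le_trans (normFD _ _))//.
by apply: lerD; rewrite (le_trans (normF_le_norm2 _ _))// ler_piMr// norm2_ge0.
Qed.

Lemma norm2_left_projection m n (P : 'M[R]_m) (Z : 'M[R]_(m, n)) :
  orthogonal_projection P -> norm2 ((1%:M - P) *m Z) <= norm2 Z.
Proof.
move=> pP; apply: norm2_le => x x1; rewrite -mulmxA.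
rewrite (le_trans (normF_left_projection _ pP).2)//.
by rewrite (le_trans (normF_le_norm2 _ _))// ler_piMr// norm2_ge0.
Qed.

End Norms.

(** * Residual of the leading singular vectors *)

Section Residual.
Context (R : realType).

Definition diag_pow n (sigma : nat -> R) j : 'M[R]_n :=
  diag_mx (\row_(i < n) sigma i.+1 ^+ j).

Definition diag_head n (sigma : nat -> R) k : 'M[R]_n :=
  diag_mx (\row_(i < n) (if (i < k)%N then sigma i.+1 else 0)).

Lemma mul_diag_pow n sigma a b :
  diag_pow n sigma a *m diag_pow n sigma b = diag_pow n sigma (a + b).
Proof.
rewrite /diag_pow mulmx_diag; congr diag_mx.
by apply/rowP => i; rewrite !mxE exprD.
Qed.

Lemma top_rows_mulmx n l c r (h : (r <= n)%N) (M : 'M[R]_(n, l))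
    (N : 'M[R]_(l, c)) :
  top_rows h (M *m N) = top_rows h M *m N.
Proof.
by apply/matrixP => i j; rewrite !mxE; apply: eq_bigr => a _; rewrite !mxE.
Qed.

Lemma bottom_rows_mulmx n l c r (h : (r <= n)%N) (M : 'M[R]_(n, l))
    (N : 'M[R]_(l, c)) :
  bottom_rows h (M *m N) = bottom_rows h M *m N.
Proof.
by apply/matrixP => i j; rewrite !mxE; apply: eq_bigr => a _; rewrite !mxE.
Qed.

Lemma mp_pinv_right m n (M : 'M[R]_(m, n)) : row_free M -> M *m mp_pinv M = 1%:M.
Proof.
move=> Mfree; have [MXM _ _ _] := moore_penroseP M.
by apply: (row_free_inj Mfree); rewrite MXM mul1mx.
Qed.

(** The residual of [sigma_i w_i] is at most its distance to any vector in the
    range of [Q]. Applying the sketch to the [i]-th column of the pseudo-inverse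
    of the top block gives such a vector: [sigma_i ^+ j.+1 w_i] plus a
    combination of the [w_a] with [a >= r], of coefficients bounded through
    [sigma_(r+1) ^+ j.+1] and the two norms. Scaled so that its [w_i] component
    is [t sigma_i w_i], it leaves a squared distance of at most
    [(1 - t)^2 sigma_1^2 + t^2 g^2]. The minimum over [t] of this quadratic is
    the harmonic expression in the statement, and keeping [t] free is what
    produces the denominators of the final bound. *)
Lemma residual_column m n l r k j (W : 'M[R]_(m, n)) (sigma : nat -> R)
    (H Q : 'M[R]_(_, l)) (T : 'M[R]_l) (hr : (r <= n)%N) (i : 'I_n) g :
  W^T *m W = 1%:M -> Q^T *m Q = 1%:M ->
  (forall a, (1 <= a <= n)%N -> 0 <= sigma a) ->
  (forall a b, (1 <= a)%N -> (a <= b)%N -> (b <= n)%N -> sigma b <= sigma a) ->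
  (i < k <= r)%N -> 0 < sigma k -> (r < n)%N ->
  row_free (top_rows hr H) ->
  W *m diag_pow n sigma j.+1 *m H = Q *m T ->
  g = sigma r.+1 ^+ j.+1 / sigma k ^+ j *
    (norm2 (bottom_rows hr H) * norm2 (mp_pinv (top_rows hr H))) ->
  normF ((1%:M - Q *m Q^T) *m W *m (sigma i.+1 *: delta_mx i 0 : 'cV[R]_n)) ^+ 2 <=
    sigma 1%N ^+ 2 * g ^+ 2 / (sigma 1%N ^+ 2 + g ^+ 2).
Proof.
move=> WW QQ sig0 sigle /andP[ik kr] sk rn Hfree WQ gE.
set E := 1%:M - Q *m Q^T.
set H1 := top_rows hr H; set H2 := bottom_rows hr H.
have ir : (i < r)%N := leq_trans ik kr.
have kn : (k <= n)%N := leq_trans kr hr.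
have sski : sigma k <= sigma i.+1 by apply: sigle.
have si : 0 < sigma i.+1 by exact: lt_le_trans sski.
have si1 : sigma i.+1 <= sigma 1%N by apply: sigle.
have s1 : 0 < sigma 1%N by exact: lt_le_trans si1.
have sr0 : 0 <= sigma r.+1 by apply: sig0.
have g0 : 0 <= g.
  by rewrite gE mulr_ge0// ?divr_ge0 ?exprn_ge0 ?mulr_ge0 ?norm2_ge0// ltW.
pose e : 'cV[R]_r := delta_mx (Ordinal ir) 0.
pose x := mp_pinv H1 *m e.
have H1x : H1 *m x = e by rewrite mulmxA mp_pinv_right// mul1mx.
have en : normF e = 1.
  apply: (@pexpIrn _ 2); rewrite ?nnegrE ?normF_ge0// expr1n.
  rewrite normF_sqr_trace trmx_delta mul_delta_mx.
  by rewrite /mxtrace big_ord1 mxE !eqxx.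
have H2x : normF (H2 *m x) <= norm2 H2 * norm2 (mp_pinv H1).
  rewrite (le_trans (normF_le_norm2 _ _))// ler_wpM2l ?norm2_ge0//.
  rewrite (le_trans (normF_le_norm2 _ _))//.
  by rewrite en mulr1.
(* the minimizer of (1 - t)^2 sigma_1^2 + t^2 g^2 *)
pose t := sigma 1%N ^+ 2 / (sigma 1%N ^+ 2 + g ^+ 2).
have den : 0 < sigma 1%N ^+ 2 + g ^+ 2.
  by rewrite ltr_pwDl ?sqr_ge0// exprn_gt0.
pose tau := t / sigma i.+1 ^+ j.
(* [W *m v] is the column minus the vector of the range of [Q] *)
pose v := sigma i.+1 *: delta_mx i 0 - tau *: (diag_pow n sigma j.+1 *m (H *m x)).
have EQ : E *m Q = 0.
  by rewrite mulmxBl mul1mx -mulmxA QQ mulmx1 subrr.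
have -> : E *m W *m (sigma i.+1 *: delta_mx i 0 : 'cV[R]_n) = E *m (W *m v).
  rewrite [in RHS]mulmxA [RHS]mulmxBr -[LHS]subr0; congr (_ - _).
  rewrite -scalemxAr !mulmxA -!(mulmxA E) WQ !mulmxA EQ.
  by rewrite !mul0mx scaler0.
have pQ := orthogonal_projection_range QQ.
rewrite (le_trans (lerXn2r _ _ _ (normF_left_projection _ pQ).2))
  ?nnegrE ?normF_ge0//.
rewrite normF_isometry// (normF_sqr_rows hr).
have vE a : v a 0 =
    sigma i.+1 * (a == i)%:R - tau * (sigma a.+1 ^+ j.+1 * (H *m x) a 0).
  by rewrite /v /diag_pow mul_diag_mx !mxE eqxx andbT.
have vtop : top_rows hr v = (sigma i.+1 * (1 - t)) *: e.
  apply/matrixP => a b; rewrite ord1 [LHS]mxE vE [RHS]mxE.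
  set a' := cast_ord _ _.
  have -> : (H *m x) a' 0 = e a 0.
    by rewrite -H1x /H1 -top_rows_mulmx [RHS]mxE.
  rewrite !mxE eqxx andbT.
  have -> : (a == Ordinal ir) = (a' == i) by rewrite -!val_eqE.
  have [->|] := eqVneq a' i; last by rewrite !mulr0 subrr.
  have -> : tau * (sigma i.+1 ^+ j.+1 * 1) = sigma i.+1 * t.
    by rewrite mulr1 [_ ^+ j.+1]exprS mulrCA divfK// expf_neq0// gt_eqF.
  by rewrite !mulr1 mulrBr mulr1.
have t0 : 0 <= t by rewrite divr_ge0 ?exprn_ge0 ?ltW.
have vbot : normF (bottom_rows hr v) ^+ 2 <= t ^+ 2 * g ^+ 2.
  have tau0 : 0 <= tau by rewrite /tau divr_ge0// exprn_ge0// ltW.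
  have tauk : tau <= t / sigma k ^+ j.
    by rewrite /tau ler_wpM2l// lef_pV2 ?posrE ?exprn_gt0// lerXn2r ?nnegrE// ltW.
  have : normF (bottom_rows hr v) ^+ 2 <=
      (tau * sigma r.+1 ^+ j.+1) ^+ 2 * normF (H2 *m x) ^+ 2.
    rewrite [leLHS]normF_sqr [in leRHS]normF_sqr mulr_sumr.
    apply: ler_sum => a _; rewrite !big_ord1 mxE vE -bottom_rows_mulmx.
    set a' := cast_ord _ _.
    rewrite [bottom_rows _ _ _ _]mxE -/a'.
    have a'E : val a' = (r + a)%N by [].
    have -> : (a' == i) = false.
      by apply/negbTE; rewrite -val_eqE a'E gtn_eqF// (leq_trans ir)// leq_addr.
    rewrite mulr0 sub0r sqrrN mulrA [leLHS]exprMn ler_wpM2r ?sqr_ge0//.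
    have sa0 : 0 <= sigma a'.+1 by apply: sig0 => /=; exact: ltn_ord a'.
    apply: lerXn2r; rewrite ?nnegrE.
    - exact: mulr_ge0 tau0 (exprn_ge0 _ sa0).
    - exact: mulr_ge0 tau0 (exprn_ge0 _ sr0).
    rewrite ler_wpM2l// lerXn2r ?nnegrE//; apply: sigle => //.
    by rewrite a'E ltnS leq_addr.
  move/le_trans; apply; rewrite -!exprMn.
  have ts0 : 0 <= tau * sigma r.+1 ^+ j.+1 := mulr_ge0 tau0 (exprn_ge0 _ sr0).
  apply: lerXn2r; rewrite ?nnegrE.
  - exact: mulr_ge0 ts0 (normF_ge0 _).
  - exact: mulr_ge0.
  rewrite gE [leRHS]mulrA; apply: ler_pM => //; first exact: normF_ge0.
  by rewrite mulrCA mulrC ler_wpM2l// exprn_ge0.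
have vtopn : normF (top_rows hr v) ^+ 2 <= sigma 1%N ^+ 2 * (1 - t) ^+ 2.
  rewrite vtop normFZ exprMn real_normK ?num_real// en expr1n mulr1 exprMn.
  by rewrite ler_wpM2r ?sqr_ge0// lerXn2r ?nnegrE// ltW.
rewrite (le_trans (lerD vtopn vbot))// le_eqVlt; apply/orP; left; apply/eqP.
by rewrite /t; field; rewrite gt_eqF.
Qed.

Lemma residual_head m n l r k j (W : 'M[R]_(m, n)) (sigma : nat -> R)
    (H : 'M[R]_(n, l)) (Q : 'M[R]_(m, l)) (T : 'M[R]_l) (hr : (r <= n)%N) h :
  W^T *m W = 1%:M -> Q^T *m Q = 1%:M ->
  (forall a, (1 <= a <= n)%N -> 0 <= sigma a) ->
  (forall a b, (1 <= a)%N -> (a <= b)%N -> (b <= n)%N -> sigma b <= sigma a) ->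
  (0 < k <= r)%N -> 0 < sigma k -> (r < n)%N ->
  row_free (top_rows hr H) ->
  W *m diag_pow n sigma j.+1 *m H = Q *m T ->
  h = sigma r.+1 ^+ j.+1 / sigma k ^+ j ->
  normF ((1%:M - Q *m Q^T) *m W *m diag_head n sigma k) <=
    Num.sqrt ((Num.sqrt k%:R * h) ^+ 2 *
        norm2 (bottom_rows hr H) ^+ 2 * norm2 (mp_pinv (top_rows hr H)) ^+ 2 /
      (1 + (h / sigma 1%N) ^+ 2 *
        norm2 (bottom_rows hr H) ^+ 2 * norm2 (mp_pinv (top_rows hr H)) ^+ 2)).
Proof.
move=> WW QQ sig0 sigle /andP[k0 kr] sk rn Hfree WQ hE.
set g2 := norm2 (bottom_rows hr H); set g1 := norm2 (mp_pinv (top_rows hr H)).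
set g := h * (g2 * g1).
have kn : (k <= n)%N := leq_trans kr hr.
have s1 : 0 < sigma 1%N by apply: lt_le_trans sk _; apply: sigle.
set c := sigma 1%N ^+ 2 * g ^+ 2 / (sigma 1%N ^+ 2 + g ^+ 2).
have den : 0 < sigma 1%N ^+ 2 + g ^+ 2 by rewrite ltr_pwDl ?sqr_ge0// exprn_gt0.
have -> : (Num.sqrt k%:R * h) ^+ 2 * g2 ^+ 2 * g1 ^+ 2 /
    (1 + (h / sigma 1%N) ^+ 2 * g2 ^+ 2 * g1 ^+ 2) = k%:R * c.
  rewrite exprMn sqr_sqrtr ?ler0n// /c.
  move: den; rewrite /g; move: (sigma 1%N) s1 => u u0 den.
  by field; rewrite !gt_eqF.
rewrite -[leLHS]ger0_norm ?normF_ge0// -sqrtr_sqr ler_wsqrtr//.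
rewrite normF_sqr_cols.
have col_head i : col i (diag_head n sigma k) =
    (if (i < k)%N then sigma i.+1 else 0) *: delta_mx i 0.
  apply/matrixP => a b; rewrite ord1 /diag_head !mxE eqxx andbT.
  by have [->|_] := eqVneq a i; rewrite ?mulr1n ?mulr0n ?mulr1 ?mulr0.
have -> : k%:R * c = \sum_(i < n | (i < k)%N) c.
  rewrite -(big_ord_widen n (fun=> c) kn) sumr_const card_ord.
  by rewrite mulr_natl.
rewrite [leRHS]big_mkcond; apply: ler_sum => i _.
rewrite colE -(mulmxA _ (diag_head _ _ _)) -colE col_head.
case: ifP => ik; last by rewrite scale0r mulmx0 normF0 expr0n.
apply: (residual_column (k := k) WW QQ sig0 sigle _ sk rn Hfree WQ).
  by rewrite ik.
by rewrite -hE.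
Qed.

Lemma svd_tailE m n k (h : (k <= n)%N) (U : 'M[R]_(m, n)) sigma (V : 'M[R]_n) :
  U *m diag_pow n sigma 1 *m V^T =
    U *m diag_head n sigma k *m V^T + svd_tail h U sigma V.
Proof.
rewrite /svd_tail /diag_pow /diag_head !mul_mx_diag; apply/matrixP => a b.
rewrite !mxE.
pose F (i : 'I_n) (x : R) := U a i * x * V b i.
transitivity (\sum_i F i (sigma i.+1)).
  by apply: eq_bigr => i _; rewrite !mxE.
have -> : \sum_i (\matrix_(i, j) (U i j *
    (\row_i0 (if (i0 < k)%N then sigma i0.+1 else 0)) 0 j)) a i * V^T i b =
    \sum_i F i (if (i < k)%N then sigma i.+1 else 0).
  by apply: eq_bigr => i _; rewrite !mxE.
have -> : \sum_j (\matrix_(i, j0) (right_cols h U i j0 *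
    (\row_j1 sigma (k + j1).+1) 0 j0)) a j * (right_cols h V)^T j b =
    \sum_i F i (if (i < k)%N then 0 else sigma i.+1).
  rewrite [RHS](reindex (cast_ord (subnKC h)))/=; last first.
    by exists (cast_ord (esym (subnKC h))) => i _; rewrite ?cast_ordK ?cast_ordKV.
  rewrite big_split_ord/= [X in _ = X + _]big1 ?add0r => [|i _]; last first.
    by rewrite /F /= ltn_ord mulr0 mul0r.
  apply: eq_bigr => i _; rewrite !mxE /F /=.
  by rewrite ltnNge leq_addr.
rewrite -big_split/=; apply: eq_bigr => i _; rewrite /F.
by case: ifP => _; ring.
Qed.

(** In the singular bases the power iterations only raise the exponent of the
    diagonal factor. *)
Lemma power_sketchE m n l (A U : 'M[R]_(m, n)) sigma (V : 'M[R]_n)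
    (Psi : 'M[R]_(n, l)) q : is_svd A U sigma V ->
  let C := iter q.+1 (power_step A) (0, Psi) in
  C.1 = U *m diag_pow n sigma (2 * q).+1 *m (V^T *m Psi) /\
  C.2 = V *m diag_pow n sigma (2 * q).+2 *m (V^T *m Psi).
Proof.
move=> [UU VV AE _ _].
have {}AE : A = U *m diag_pow n sigma 1 *m V^T by [].
have ATE : A^T = V *m diag_pow n sigma 1 *m U^T.
  by rewrite AE !trmx_mul trmxK tr_diag_mx mulmxA.
have step2 a (Z : 'M[R]_(n, l)) : A^T *m (U *m diag_pow n sigma a *m Z) =
    V *m diag_pow n sigma a.+1 *m Z.
  rewrite ATE !mulmxA -(mulmxA _ U^T) UU mulmx1.
  by rewrite -(mulmxA V) mul_diag_pow add1n.
move=> C; rewrite {}/C; elim: q => [|q [_]].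
  rewrite /=; have E : A *m Psi = U *m diag_pow n sigma 1 *m (V^T *m Psi).
    by rewrite AE !mulmxA.
  by rewrite E step2.
rewrite (iterS q.+1); move: (iter q.+1 _ _) => C IH2; rewrite /power_step /= IH2.
have E : A *m (V *m diag_pow n sigma (2 * q).+2 *m (V^T *m Psi)) =
    U *m diag_pow n sigma (2 * q.+1).+1 *m (V^T *m Psi).
  rewrite AE !mulmxA -(mulmxA _ V^T V) VV mulmx1 -(mulmxA U) mul_diag_pow.
  by rewrite add1n mulnS.
by rewrite E step2.
Qed.

End Residual.

(** * Error of the decomposition *)

Section ErrorSplit.
Context (R : realType).

Lemma utv_productE m n l (A : 'M[R]_(m, n)) (C1 : 'M[R]_(m, l)) (C2 : 'M[R]_(n, l))
    U T V : utv_of_sketches A C1 C2 U T V ->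
  exists Q1 R1 Q2 R2, [/\ reduced_qr C1 Q1 R1, reduced_qr C2 Q2 R2 &
    U *m T *m V^T = (Q1 *m Q1^T) *m A *m (Q2 *m Q2^T)].
Proof.
move=> [Q1 [R1 [Q2 [R2 [Qt [Rt [Pt [qr1 qr2 [_ _ _ DE] [-> -> ->]]]]]]]]].
exists Q1, R1, Q2, R2; split=> //.
by rewrite trmx_mul !mulmxA -(mulmxA Q1) -(mulmxA Q1 (Qt *m Rt)) -DE !mulmxA.
Qed.

(** If the second range contains that of [A^T *m Q1], then projecting the rows
    of [Q1^T *m A] onto it changes nothing. *)
Lemma projection_absorb m n l l' (A : 'M[R]_(m, n)) (Q1 : 'M[R]_(m, l'))
    (Q2 : 'M[R]_(n, l)) X :
  Q2^T *m Q2 = 1%:M -> A^T *m Q1 = Q2 *m X ->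
  Q1^T *m A *m (Q2 *m Q2^T) = Q1^T *m A.
Proof.
move=> QQ2 AQ; have -> : Q1^T *m A = X^T *m Q2^T.
  by rewrite -[A in LHS]trmxK -trmx_mul AQ trmx_mul.
by rewrite !mulmxA -(mulmxA X^T) QQ2 mulmx1.
Qed.

(** The inverse of a zero singular value is 0, which makes [Z] a generalized
    inverse without separating the null singular values. *)
Lemma svd_adjoint_factor m n (A U : 'M[R]_(m, n)) sigma (V : 'M[R]_n) :
  is_svd A U sigma V -> exists Z, A^T = A^T *m A *m Z.
Proof.
move=> [UU VV AE _ _].
have {}AE : A = U *m diag_pow n sigma 1 *m V^T by [].
have ATE : A^T = V *m diag_pow n sigma 1 *m U^T.
  by rewrite AE !trmx_mul trmxK tr_diag_mx mulmxA.
exists (V *m diag_mx (\row_(i < n) (sigma i.+1)^-1) *m U^T).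
rewrite ATE AE !mulmxA.
rewrite -(mulmxA _ U^T U) UU mulmx1 -(mulmxA _ V^T V) VV mulmx1.
rewrite -!(mulmxA V); congr (V *m (_ *m _)).
rewrite /diag_pow !mulmx_diag; congr diag_mx; apply/rowP => i; rewrite !mxE expr1.
have [->|s0] := eqVneq (sigma i.+1) 0; first by rewrite !mul0r.
by rewrite mulfK.
Qed.

(** When the sketch has as much rank as its size and [A] allow, the two-sided
    compression of [A] reduces to the left one. Either the sketch has full
    column rank, and then [Q1] has the range of the sketch, so that the range of
    [A^T *m Q1] is the range of the second sketch; or the sketch has the range
    of [A], and then [Q2] contains the range of [A^T]. A sketch of smaller rank
    leaves columns of [Q1] arbitrary, and the conclusion may fail. *)
Lemma sketch_range m n l (A : 'M[R]_(m, n)) (N : 'M[R]_(n, l)) Z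
    (Q1 : 'M[R]_(m, l)) R1 (Q2 : 'M[R]_(n, l)) R2 :
  A^T = A^T *m A *m Z ->
  reduced_qr (A *m N) Q1 R1 -> reduced_qr (A^T *m (A *m N)) Q2 R2 ->
  (minn l (\rank A) <= \rank (A *m N))%N ->
  (Q1 *m Q1^T) *m A *m (Q2 *m Q2^T) = Q1 *m Q1^T *m A.
Proof.
move=> AZ [_ _ CE1] [QQ2 _ CE2]; rewrite geq_min => /orP[lrk|Ark].
  have R1U : R1 \in unitmx.
    rewrite -row_free_unit /row_free eqn_leq rank_leq_row/= (leq_trans lrk)//.
    by rewrite CE1 mxrankM_maxr.
  have AQ : A^T *m Q1 = Q2 *m (R2 *m invmx R1).
    by rewrite mulmxA -CE2 CE1 mulmxA mulmxK.
  by rewrite -!(mulmxA Q1) mulmxA -(mulmxA Q1) (projection_absorb QQ2 AQ).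
have /submxP[Y AY] : (A^T <= (A *m N)^T)%MS.
  have sub : ((A *m N)^T <= A^T)%MS by rewrite trmx_mul submxMl.
  have [_ <-] := mxrank_leqif_sup sub.
  by rewrite !mxrank_tr eqn_leq Ark mxrankM_maxl.
have AE : A = A *m N *m Y^T by rewrite -[LHS]trmxK AY trmx_mul !trmxK.
have AQ : A^T *m 1%:M = Q2 *m (R2 *m Y^T *m Z).
  by rewrite mulmx1 AZ {2}AE !mulmxA -CE2 !mulmxA.
have := projection_absorb QQ2 AQ; rewrite trmx1 !mul1mx => AP.
by rewrite -(mulmxA (Q1 *m _)) AP.
Qed.

(** [A] factors through this matrix: null singular values are harmless because
    [0 ^+ (2 * q).+1 = 0]. *)
Lemma svd_rank_odd_power m n (A U : 'M[R]_(m, n)) sigma (V : 'M[R]_n) q :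
  is_svd A U sigma V ->
  (\rank A <= \rank (U *m diag_pow n sigma (2 * q).+1 *m V^T))%N.
Proof.
move=> [UU VV AE _ _].
pose D := diag_mx (\row_(i < n) (sigma i.+1 ^+ (2 * q))^-1).
have -> : A = U *m diag_pow n sigma (2 * q).+1 *m V^T *m (V *m D *m V^T).
  rewrite !mulmxA -(mulmxA _ V^T V) VV mulmx1 -(mulmxA U) AE; congr (_ *m _ *m _).
  rewrite /diag_pow /D mulmx_diag; congr diag_mx; apply/rowP => i; rewrite !mxE.
  have [->|s0] := eqVneq (sigma i.+1) 0; first by rewrite exprS !mul0r.
  by rewrite exprS mulfK// expf_neq0.
exact: mxrankM_maxl.
Qed.

Lemma error_split_F m n (A Ak A0 : 'M[R]_(m, n)) (P1 : 'M[R]_m) (P2 : 'M[R]_n) :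
  orthogonal_projection P1 -> orthogonal_projection P2 -> A = Ak + A0 ->
  normF (A - P1 *m A *m P2) <= normF A0 +
    (normF (Ak *m (1%:M - P2)) + normF ((1%:M - P1) *m Ak)).
Proof.
move=> pP1 pP2 AE.
rewrite (le_trans (normF_proj_optimal A Ak pP1 pP2))//.
have -> : A - P1 *m Ak *m P2 =
    A0 + (P1 *m (Ak *m (1%:M - P2)) + (1%:M - P1) *m Ak).
  rewrite AE mulmxBr mulmx1 mulmxBl mul1mx mulmxBr mulmxA.
  by apply/matrixP => i j; rewrite !mxE; ring.
rewrite (le_trans (normFD _ _))// lerD2l (le_trans (normFD _ _))// lerD2r.
exact: (normF_left_projection _ pP1).1.
Qed.

Lemma error_split_2 m n (A Ak A0 : 'M[R]_(m, n)) (P1 : 'M[R]_m) :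
  orthogonal_projection P1 -> A = Ak + A0 ->
  norm2 (A - P1 *m A) <= norm2 A0 + normF ((1%:M - P1) *m Ak).
Proof.
move=> pP1 AE.
have -> : A - P1 *m A = (1%:M - P1) *m A0 + (1%:M - P1) *m Ak.
  by rewrite -mulmxDr [A0 + Ak]addrC -AE mulmxBl mul1mx.
rewrite (le_trans (norm2D _ _))// lerD ?norm2_le_normF//.
exact: norm2_left_projection.
Qed.

(** The four power-method parameters all reduce to the two gains
    [s ^+ j.+1 / sk ^+ j], with [j = 2 * q] for the left sketch and
    [j = (2 * q).+1] for the right one. *)
Lemma gain_odd (s sk : R) n : s * (s / sk) ^+ n = s ^+ n.+1 / sk ^+ n.
Proof. by rewrite expr_div_n mulrA -exprS. Qed.

Lemma gain_even (s sk : R) n :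
  s ^+ 2 / sk * (s / sk) ^+ n = s ^+ n.+2 / sk ^+ n.+1.
Proof. by rewrite expr_div_n mulrACA -exprD -invfM -exprS. Qed.

Lemma alpha_power_ratio q k (sk s : R) : alpha_power q k sk s =
  Num.sqrt k%:R * (s ^+ (2 * q).+2 / sk ^+ (2 * q).+1).
Proof. by rewrite /alpha_power -mulrA gain_even. Qed.

Lemma beta_power_ratio q (s1 sk s : R) : beta_power q s1 sk s =
  s ^+ (2 * q).+2 / sk ^+ (2 * q).+1 / s1.
Proof. by rewrite /beta_power -gain_even invfM; ring. Qed.

Lemma eta_power_ratio q k (sk s : R) : eta_power q k sk s =
  Num.sqrt k%:R * (s ^+ (2 * q).+1 / sk ^+ (2 * q)).
Proof. by rewrite /eta_power -mulrA gain_odd. Qed.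

Lemma tau_power_ratio q (s1 sk s : R) : tau_power q s1 sk s =
  s ^+ (2 * q).+1 / sk ^+ (2 * q) / s1.
Proof. by rewrite /tau_power -gain_odd mulrAC. Qed.

(** The deterministic part: the Frobenius bound holds for every run of the
    algorithm, the spectral one when the left sketch has maximal rank. *)
Lemma cor_utv_power_error m n k l r q (A U0 : 'M[R]_(m, n)) sigma (V0 : 'M[R]_n)
    (Psi : 'M[R]_(n, l)) (hk : (k <= n)%N) (hr : (r <= n)%N) U T V :
  is_svd A U0 sigma V0 -> 0 < sigma k -> (0 < k <= r)%N -> (r < n)%N ->
  row_free (top_rows hr (V0^T *m Psi)) ->
  cor_utv_power q A Psi U T V ->
  let bound := gaussian_terms (alpha_power q k (sigma k) (sigma r.+1))
       (beta_power q (sigma 1%N) (sigma k) (sigma r.+1))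
       (eta_power q k (sigma k) (sigma r.+1))
       (tau_power q (sigma 1%N) (sigma k) (sigma r.+1))
       (norm2 (bottom_rows hr (V0^T *m Psi)))
       (norm2 (mp_pinv (top_rows hr (V0^T *m Psi)))) in
  normF (A - U *m T *m V^T) <= normF (svd_tail hk U0 sigma V0) + bound /\
  ((minn l (\rank A) <=
     \rank (U0 *m diag_pow n sigma (2 * q).+1 *m V0^T *m Psi))%N ->
   norm2 (A - U *m T *m V^T) <= norm2 (svd_tail hk U0 sigma V0) + bound).
Proof.
move=> svdA sk kr rn free utv bound.
have [UU VV AE sig0 sigle] := svdA.
have [C1E C2E] := power_sketchE Psi q svdA.
have [Q1 [R1 [Q2 [R2 [qr1 qr2 ->]]]]] := utv_productE utv.
have [QQ1 _ CQ1] := qr1; have [QQ2 _ CQ2] := qr2.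
have pQ1 := orthogonal_projection_range QQ1.
have pQ2 := orthogonal_projection_range QQ2.
set A0 := svd_tail hk U0 sigma V0.
pose Ak := U0 *m diag_head n sigma k *m V0^T.
have AkE : A = Ak + A0 by rewrite -svd_tailE.
have s1 : 0 < sigma 1%N.
  by case/andP: kr => k0 kr; apply: lt_le_trans sk _; apply: sigle.
set g2 := norm2 (bottom_rows hr (V0^T *m Psi)) in bound *.
set g1 := norm2 (mp_pinv (top_rows hr (V0^T *m Psi))) in bound *.
have alphaB : normF (Ak *m (1%:M - Q2 *m Q2^T)) <=
   Num.sqrt (alpha_power q k (sigma k) (sigma r.+1) ^+ 2 * g2 ^+ 2 * g1 ^+ 2 /
     (1 + beta_power q (sigma 1%N) (sigma k) (sigma r.+1) ^+ 2 * g2 ^+ 2 * g1 ^+ 2)).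
  rewrite alpha_power_ratio beta_power_ratio.
  apply: le_trans (residual_head VV QQ2 sig0 sigle kr sk rn free
    (etrans (esym C2E) CQ2) erefl).
  rewrite -normF_tr trmx_mul linearB/= trmx1 trmx_mul trmxK /Ak !trmx_mul trmxK.
  by rewrite tr_diag_mx !mulmxA normF_coisometry.
have etaB : normF ((1%:M - Q1 *m Q1^T) *m Ak) <=
   Num.sqrt (eta_power q k (sigma k) (sigma r.+1) ^+ 2 * g2 ^+ 2 * g1 ^+ 2 /
     (1 + tau_power q (sigma 1%N) (sigma k) (sigma r.+1) ^+ 2 * g2 ^+ 2 * g1 ^+ 2)).
  rewrite eta_power_ratio tau_power_ratio.
  apply: le_trans (residual_head UU QQ1 sig0 sigle kr sk rn free
    (etrans (esym C1E) CQ1) erefl).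
  by rewrite /Ak !mulmxA normF_coisometry.
split.
  by rewrite (le_trans (error_split_F pQ1 pQ2 AkE))// lerD2l lerD.
move=> rk; have [Z AZ] := svd_adjoint_factor svdA.
pose N := (iter q (power_step A) (0, Psi)).2.
have C1N : (iter q.+1 (power_step A) (0, Psi)).1 = A *m N by [].
have C2N : (iter q.+1 (power_step A) (0, Psi)).2 = A^T *m (A *m N) by [].
rewrite C1N in qr1; rewrite C2N in qr2.
rewrite (sketch_range AZ qr1 qr2); last by rewrite -C1N C1E mulmxA.
rewrite (le_trans (error_split_2 pQ1 AkE))// lerD2l (le_trans etaB)//.
by rewrite lerDr sqrtr_ge0.
Qed.

End ErrorSplit.

Theorem theorem6 (R : realType) (d : measure_display) (Omega : measurableType d)
    (P : probability Omega R) (m n k l p : nat)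
    (A UA : 'M[R]_(m, n)) (sigma : nat -> R) (VA : 'M[R]_n)
    (Psi : 'I_n -> 'I_l -> {RV P >-> R})
    (hnm : (n <= m)%N) (hk : (0 < k)%N) (hkl : (k <= l)%N) (hln : (l < n)%N)
    (hp : (2 <= p + k <= l)%N)
    (hA : is_svd A UA sigma VA) (hsigma : 0 < sigma k)
    (hPsi : iid_standard_gaussian Psi) :
  let hkn : (k <= n)%N := leq_trans hkl (ltnW hln) in
  let hr : (l - p <= n)%N := leq_trans (leq_subr p l) (ltnW hln) in
  let A0 := svd_tail hkn UA sigma VA in
  let Psi1 w := top_rows hr (VA^T *m rv_mx Psi w) in
  let Psi2 w := bottom_rows hr (VA^T *m rv_mx Psi w) in
  let s := sigma (l - p).+1 in
  (let bound w :=
     gaussian_terms (alpha_basic k (sigma k) s) (beta_basic (sigma 1%N) (sigma k) s)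
       (eta_basic k s) (tau_basic (sigma 1%N) s)
       (norm2 (Psi2 w)) (norm2 (mp_pinv (Psi1 w))) in
   (forall w, row_free (Psi1 w) ->
      forall U T V, cor_utv A (rv_mx Psi w) U T V ->
      normF (A - U *m T *m V^T) <= normF A0 + bound w) /\
   {ae P, forall w, row_free (Psi1 w) ->
      forall U T V, cor_utv A (rv_mx Psi w) U T V ->
      norm2 (A - U *m T *m V^T) <= norm2 A0 + bound w}) /\
  (forall q : nat,
   let bound w :=
     gaussian_terms (alpha_power q k (sigma k) s)
       (beta_power q (sigma 1%N) (sigma k) s)
       (eta_power q k (sigma k) s) (tau_power q (sigma 1%N) (sigma k) s)
       (norm2 (Psi2 w)) (norm2 (mp_pinv (Psi1 w))) in
   (forall w, row_free (Psi1 w) ->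
      forall U T V, cor_utv_power q A (rv_mx Psi w) U T V ->
      normF (A - U *m T *m V^T) <= normF A0 + bound w) /\
   {ae P, forall w, row_free (Psi1 w) ->
      forall U T V, cor_utv_power q A (rv_mx Psi w) U T V ->
      norm2 (A - U *m T *m V^T) <= norm2 A0 + bound w}).
Proof.
move=> hkn hr A0 Psi1 Psi2 s.
have hkp : (k <= l - p)%N.
  by rewrite leq_subRL ?(leq_trans (leq_addr k p)); case/andP: hp.
have kr : (0 < k <= l - p)%N by rewrite hk.
have rn : (l - p < n)%N by rewrite (leq_ltn_trans (leq_subr p l)).
have power q w U T V (free : row_free (Psi1 w)) :=
  @cor_utv_power_error R m n k l (l - p) q A UA sigma VA (rv_mx Psi w) hkn hr U T V
    hA hsigma kr rn free.
have rank_ae q : {ae P, forall w, (minn l (\rank A) <=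
    \rank (UA *m diag_pow n sigma (2 * q).+1 *m VA^T *m rv_mx Psi w))%N}.
  apply: filterS (gaussian_sketch_rank
    (UA *m diag_pow n sigma (2 * q).+1 *m VA^T) hPsi) => w; apply: leq_trans.
  rewrite leq_min geq_minl/= (leq_trans (geq_minr _ _))//.
  exact: svd_rank_odd_power hA.
have all_q q : let bound w :=
     gaussian_terms (alpha_power q k (sigma k) s)
       (beta_power q (sigma 1%N) (sigma k) s)
       (eta_power q k (sigma k) s) (tau_power q (sigma 1%N) (sigma k) s)
       (norm2 (Psi2 w)) (norm2 (mp_pinv (Psi1 w))) in
   (forall w, row_free (Psi1 w) ->
      forall U T V, cor_utv_power q A (rv_mx Psi w) U T V ->
      normF (A - U *m T *m V^T) <= normF A0 + bound w) /\
   {ae P, forall w, row_free (Psi1 w) ->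
      forall U T V, cor_utv_power q A (rv_mx Psi w) U T V ->
      norm2 (A - U *m T *m V^T) <= norm2 A0 + bound w}.
  split; first by move=> w free U T V /(power q w U T V free)[].
  apply: filterS (rank_ae q) => w rk free U T V.
  by move=> /(power q w U T V free)[_]; apply.
split; last exact: all_q.
(* the basic algorithm is, by conversion, the power method with [q = 0] *)
have := all_q 0%N.
by rewrite /alpha_power /beta_power /eta_power /tau_power muln0 expr0 !mulr1.
Qed.
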